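(* Let $\mathcal{E}$ be a category with finite products and let $(\mathcal{C},\otimes,I)$ be a monoidal category. Denote by $(\mathcal{E},\times,\mathbf{1})$ the category $\mathcal{E}$ equipped with the cartesian monoidal structure. Then to give an oplax monoidal functor $L\colon(\mathcal{E},\times,\mathbf{1})\to(\mathcal{C},\otimes,I)$ is to give a functor $L\colon\mathcal{E}\to\mathcal{C}$ together with morphisms $$\Phi_T\colon L(T)\to L(T)\otimes L(T),\qquad\Lambda_T\colon L(T)\to I$$ for every $T\in\mathcal{E}$, such that: (i) for every $T\in\mathcal{E}$, the composite $(LT\otimes\Lambda_T)\circ\Phi_T$ is the unitor $LT\to LT\otimes I$ and the composite $(\Lambda_T\otimes LT)\circ\Phi_T$ is the unitor $LT\to I\otimes LT$; (ii) for every $T\in\mathcal{E}$, $\mathrm{assoc}\circ(LT\otimes\Phi_T)\circ\Phi_T=(\Phi_T\otimes LT)\circ\Phi_T$ as morphisms $LT\to(LT\otimes LT)\otimes LT$; (iii) for every morphism $f\colon T\to T'$ in $\mathcal{E}$, $\Lambda_{T'}\circ Lf=\Lambda_T$ and $\Phi_{T'}\circ Lf=(Lf\otimes Lf)\circ\Phi_T$.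
   Context: An oplax monoidal functor $L\colon(\mathcal{E},\times,\mathbf{1})\to(\mathcal{C},\otimes,I)$ is a functor $L$ with morphisms $L(A\times B)\to LA\otimes LB$ natural in $A,B$ and a morphism $L\mathbf{1}\to I$, satisfying the usual associativity and unit axioms. ''assoc'' and ''unitor'' denote the appropriate components of the associativity and unit constraints of $\mathcal{C}$ (or their inverses); an object in a tensor product of morphisms stands for its identity. ''To give … is to give …'' means that, for a fixed underlying functor $L$, the two kinds of structure are in bijection. *)

(* Defs.v *)
From mathcomp Require Import ssreflect ssrfun.

Set Implicit Arguments.
Unset Strict Implicit.
Unset Printing Implicit Defensive.

Declare Scope cat_scope.
Delimit Scope cat_scope with cat.
Local Open Scope cat_scope.

Reserved Notation "A ~> B" (at level 75, no associativity).
Reserved Notation "g ∘ f" (at level 45, left associativity).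
Reserved Notation "A ⊗ B" (at level 40, left associativity).
Reserved Notation "f ⊗m g" (at level 40, left associativity).

Record category := Category {
  obj :> Type;
  hom : obj -> obj -> Type;
  idm : forall A, hom A A;
  comp : forall A B C, hom B C -> hom A B -> hom A C;
  comp_idl : forall A B (f : hom A B), comp (idm B) f = f;
  comp_idr : forall A B (f : hom A B), comp f (idm A) = f;
  comp_assoc : forall A B C D (h : hom C D) (g : hom B C) (f : hom A B),
    comp h (comp g f) = comp (comp h g) f
}.

Arguments hom {c} A B.
Arguments idm {c} A.
Arguments comp {c A B C} g f.

Notation "A ~> B" := (hom A B) : cat_scope.
Notation "g ∘ f" := (comp g f) : cat_scope.

Record functor (C D : category) := Functor {
  fobj :> C -> D;
  fmap : forall A B : C, A ~> B -> fobj A ~> fobj B;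
  fmap_id : forall A : C, fmap (idm A) = idm (fobj A);
  fmap_comp : forall (A B X : C) (g : B ~> X) (f : A ~> B),
    fmap (g ∘ f) = fmap g ∘ fmap f
}.

Arguments fmap {C D} f {A B} _ : rename.

(* The constraints are isomorphisms [assoc : (A ⊗ B) ⊗ X -> A ⊗ (B ⊗ X)],
   [lunit : I ⊗ A -> A] and [runit : A ⊗ I -> A], given with their inverses. *)
Record monoidal_category := MonoidalCategory {
  mcat :> category;
  tensor : mcat -> mcat -> mcat;
  tensorm : forall A A' B B' : mcat,
    A ~> A' -> B ~> B' -> tensor A B ~> tensor A' B';
  munit : mcat;
  assoc : forall A B X, tensor (tensor A B) X ~> tensor A (tensor B X);
  assoc_inv : forall A B X, tensor A (tensor B X) ~> tensor (tensor A B) X;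
  lunit : forall A, tensor munit A ~> A;
  lunit_inv : forall A, A ~> tensor munit A;
  runit : forall A, tensor A munit ~> A;
  runit_inv : forall A, A ~> tensor A munit;
  tensorm_id : forall A B, tensorm (idm A) (idm B) = idm (tensor A B);
  tensorm_comp : forall (A A' A'' B B' B'' : mcat)
      (f' : A' ~> A'') (f : A ~> A') (g' : B' ~> B'') (g : B ~> B'),
    tensorm (f' ∘ f) (g' ∘ g) = tensorm f' g' ∘ tensorm f g;
  assocK : forall A B X, assoc_inv A B X ∘ assoc A B X = idm _;
  assoc_invK : forall A B X, assoc A B X ∘ assoc_inv A B X = idm _;
  lunitK : forall A, lunit_inv A ∘ lunit A = idm _;
  lunit_invK : forall A, lunit A ∘ lunit_inv A = idm _;
  runitK : forall A, runit_inv A ∘ runit A = idm _;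
  runit_invK : forall A, runit A ∘ runit_inv A = idm _;
  assoc_nat : forall (A A' B B' X X' : mcat)
      (f : A ~> A') (g : B ~> B') (h : X ~> X'),
    assoc A' B' X' ∘ tensorm (tensorm f g) h =
    tensorm f (tensorm g h) ∘ assoc A B X;
  lunit_nat : forall (A A' : mcat) (f : A ~> A'),
    lunit A' ∘ tensorm (idm munit) f = f ∘ lunit A;
  runit_nat : forall (A A' : mcat) (f : A ~> A'),
    runit A' ∘ tensorm f (idm munit) = f ∘ runit A;
  pentagon : forall A B X Y : mcat,
    assoc A B (tensor X Y) ∘ assoc (tensor A B) X Y =
    tensorm (idm A) (assoc B X Y) ∘ assoc A (tensor B X) Y
      ∘ tensorm (assoc A B X) (idm Y);
  triangle : forall A B : mcat,
    tensorm (idm A) (lunit B) ∘ assoc A munit B = tensorm (runit A) (idm B)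
}.

Arguments tensor {m} A B.
Arguments tensorm {m A A' B B'} f g.
Arguments munit m : clear implicits.
Arguments assoc {m} A B X.
Arguments assoc_inv {m} A B X.
Arguments lunit {m} A.
Arguments lunit_inv {m} A.
Arguments runit {m} A.
Arguments runit_inv {m} A.

Notation "A ⊗ B" := (tensor A B) : cat_scope.
Notation "f ⊗m g" := (tensorm f g) : cat_scope.

(* Finite products, as a choice of a terminal object and of binary products. *)
Record finite_products (E : category) := FiniteProducts {
  term : E;
  bang : forall A : E, A ~> term;
  bang_uniq : forall (A : E) (f : A ~> term), f = bang A;
  prodo : E -> E -> E;
  proj1 : forall A B : E, prodo A B ~> A;
  proj2 : forall A B : E, prodo A B ~> B;
  pairing : forall X A B : E, X ~> A -> X ~> B -> X ~> prodo A B;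
  proj1_pairing : forall (X A B : E) (f : X ~> A) (g : X ~> B),
    proj1 A B ∘ pairing f g = f;
  proj2_pairing : forall (X A B : E) (f : X ~> A) (g : X ~> B),
    proj2 A B ∘ pairing f g = g;
  pairing_uniq : forall (X A B : E) (h : X ~> prodo A B),
    h = pairing (proj1 A B ∘ h) (proj2 A B ∘ h)
}.

Arguments term {E} f : rename.
Arguments bang {E} f A : rename.
Arguments prodo {E} f A B : rename.
Arguments proj1 {E} f A B : rename.
Arguments proj2 {E} f A B : rename.
Arguments pairing {E} f {X A B} _ _ : rename.

Definition diag (E : category) (P : finite_products E) (A : E) :
  A ~> prodo P A A := pairing P (idm A) (idm A).

Section CartesianMonoidal.
Variables (E : category) (P : finite_products E).

Local Notation "A × B" := (prodo P A B) (at level 40, left associativity).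
Local Notation p1 := (proj1 P _ _).
Local Notation p2 := (proj2 P _ _).
Local Notation "⟨ f , g ⟩" := (pairing P f g).

Definition prodm (A A' B B' : E) (f : A ~> A') (g : B ~> B') : A × B ~> A' × B' :=
  ⟨f ∘ p1, g ∘ p2⟩.

Definition prod_assoc (A B X : E) : (A × B) × X ~> A × (B × X) :=
  ⟨p1 ∘ p1, ⟨p2 ∘ p1, p2⟩⟩.

Definition prod_assoc_inv (A B X : E) : A × (B × X) ~> (A × B) × X :=
  ⟨⟨p1, p1 ∘ p2⟩, p2 ∘ p2⟩.

Lemma pairing_comp (Y X A B : E) (f : X ~> A) (g : X ~> B) (h : Y ~> X) :
  ⟨f, g⟩ ∘ h = ⟨f ∘ h, g ∘ h⟩.
Proof.
by rewrite [LHS]pairing_uniq !comp_assoc proj1_pairing proj2_pairing.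
Qed.

Lemma prod_ext (X A B : E) (f g : X ~> A × B) :
  p1 ∘ f = p1 ∘ g -> p2 ∘ f = p2 ∘ g -> f = g.
Proof. by move=> e1 e2; rewrite (pairing_uniq f) (pairing_uniq g) e1 e2. Qed.

Lemma bang_ext (A : E) (f g : A ~> term P) : f = g.
Proof. by rewrite (bang_uniq f) (bang_uniq g). Qed.

Lemma proj1_pairing_comp (Y X A B : E) (f : X ~> A) (g : X ~> B) (h : A ~> Y) :
  h ∘ p1 ∘ ⟨f, g⟩ = h ∘ f.
Proof. by rewrite -comp_assoc proj1_pairing. Qed.

Lemma proj2_pairing_comp (Y X A B : E) (f : X ~> A) (g : X ~> B) (h : B ~> Y) :
  h ∘ p2 ∘ ⟨f, g⟩ = h ∘ g.
Proof. by rewrite -comp_assoc proj2_pairing. Qed.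

Local Ltac prod_solve :=
  intros; rewrite /prodm /prod_assoc /prod_assoc_inv;
  repeat (try first [ apply: bang_ext | apply: prod_ext ];
    rewrite ?(pairing_comp, comp_assoc, proj1_pairing_comp, proj2_pairing_comp,
              proj1_pairing, proj2_pairing, comp_idl, comp_idr) //).

Definition cartesian_monoidal : monoidal_category.
Proof.
refine (@MonoidalCategory E (prodo P) prodm (term P)
  prod_assoc prod_assoc_inv
  (fun A => proj2 P (term P) A) (fun A => ⟨bang P A, idm A⟩)
  (fun A => proj1 P A (term P)) (fun A => ⟨idm A, bang P A⟩)
  _ _ _ _ _ _ _ _ _ _ _ _ _); abstract prod_solve.
Defined.

End CartesianMonoidal.

(* The oplax monoidal structures on a fixed functor [L]. *)
Record oplax_monoidal (D C : monoidal_category) (L : functor D C) := OplaxMonoidal {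
  oplax_tensor : forall A B : D, L (A ⊗ B) ~> L A ⊗ L B;
  oplax_unit : L (munit D) ~> munit C;
  oplax_tensor_nat : forall (A A' B B' : D) (f : A ~> A') (g : B ~> B'),
    oplax_tensor A' B' ∘ fmap L (f ⊗m g) =
    (fmap L f ⊗m fmap L g) ∘ oplax_tensor A B;
  oplax_assoc : forall A B X : D,
    assoc (L A) (L B) (L X) ∘ (oplax_tensor A B ⊗m idm (L X))
      ∘ oplax_tensor (A ⊗ B) X =
    (idm (L A) ⊗m oplax_tensor B X) ∘ oplax_tensor A (B ⊗ X)
      ∘ fmap L (assoc A B X);
  oplax_lunit : forall A : D,
    lunit (L A) ∘ (oplax_unit ⊗m idm (L A)) ∘ oplax_tensor (munit D) A =
    fmap L (lunit A);
  oplax_runit : forall A : D,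
    runit (L A) ∘ (idm (L A) ⊗m oplax_unit) ∘ oplax_tensor A (munit D) =
    fmap L (runit A)
}.

Arguments oplax_tensor {D C L} o A B : rename.
Arguments oplax_unit {D C L} o : rename.

Record natural_comonoids (E : category) (C : monoidal_category) (L : functor E C) :=
  NaturalComonoids {
  Phi : forall T : E, L T ~> L T ⊗ L T;
  Lambda : forall T : E, L T ~> munit C;
  Phi_counitr : forall T : E, (idm (L T) ⊗m Lambda T) ∘ Phi T = runit_inv (L T);
  Phi_counitl : forall T : E, (Lambda T ⊗m idm (L T)) ∘ Phi T = lunit_inv (L T);
  Phi_coassoc : forall T : E,
    assoc_inv (L T) (L T) (L T) ∘ (idm (L T) ⊗m Phi T) ∘ Phi T =
    (Phi T ⊗m idm (L T)) ∘ Phi T;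
  Lambda_nat : forall (T T' : E) (f : T ~> T'), Lambda T' ∘ fmap L f = Lambda T;
  Phi_nat : forall (T T' : E) (f : T ~> T'),
    Phi T' ∘ fmap L f = (fmap L f ⊗m fmap L f) ∘ Phi T
}.

Arguments Phi {E C L} n T : rename.
Arguments Lambda {E C L} n T : rename.

(* Main.v *)
Require Import Defs.
From mathcomp Require Import ssreflect ssrfun.
From Stdlib Require Import FunctionalExtensionality ProofIrrelevance.
Local Open Scope cat_scope.

(** In a category with finite products every object [T] is a comonoid in a
    unique way, with comultiplication the diagonal and counit the map to the
    terminal object, and every morphism respects these comonoids.  An oplax
    monoidal functor [L] carries comonoids to comonoids, so it equips every
    [L T] with [Phi T = oplax_tensor T T ∘ L diag] and
    [Lambda T = oplax_unit ∘ L bang], naturally in [T].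

    Conversely, a natural comonoid structure determines the maps
    [(L proj1 ⊗ L proj2) ∘ Phi (A × B) : L (A × B) ~> L A ⊗ L B] and
    [Lambda term].

    Both directions rest on one identity, the formula
    [oplax_tensor A B ∘ L ⟨f, g⟩ = (L f ⊗ L g) ∘ Phi X] for [f : X ~> A] and
    [g : X ~> B].  When [Phi] comes from an oplax structure it follows from
    [⟨f, g⟩ = (f × g) ∘ diag] and the naturality of [oplax_tensor]
    ([oplax_tensor_pairing]); when the tensor constraint comes from [Phi] it
    follows from the naturality of [Phi] ([comult_tensor_pairing]).  It turns
    each axiom on one side into an axiom on the other by a suitable choice of
    [f] and [g].  Taking [⟨proj1, proj2⟩ = idm] and [⟨idm, idm⟩ = diag] it also
    shows that the two constructions are mutually inverse. *)

(** * Tensor products of composites *)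

Section TensorLemmas.

Set Implicit Arguments.
Unset Strict Implicit.

Variable C : monoidal_category.

Lemma tensorm_comp_assoc (Z A A' A'' B B' B'' : C)
    (f' : A' ~> A'') (f : A ~> A') (g' : B' ~> B'') (g : B ~> B')
    (h : Z ~> A ⊗ B) :
  (f' ⊗m g') ∘ ((f ⊗m g) ∘ h) = ((f' ∘ f) ⊗m (g' ∘ g)) ∘ h.
Proof. by rewrite comp_assoc -tensorm_comp. Qed.

Lemma lunit_inv_eq (A B : C) (f : B ~> munit C ⊗ A) (g : B ~> A) :
  lunit A ∘ f = g -> f = lunit_inv A ∘ g.
Proof. by move=> <-; rewrite comp_assoc lunitK comp_idl. Qed.

Lemma runit_inv_eq (A B : C) (f : B ~> A ⊗ munit C) (g : B ~> A) :
  runit A ∘ f = g -> f = runit_inv A ∘ g.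
Proof. by move=> <-; rewrite comp_assoc runitK comp_idl. Qed.

Lemma assoc_inv_eq (A B X Y : C) (f : Y ~> (A ⊗ B) ⊗ X) (g : Y ~> A ⊗ (B ⊗ X)) :
  assoc A B X ∘ f = g -> assoc_inv A B X ∘ g = f.
Proof. by move=> <-; rewrite comp_assoc assocK comp_idl. Qed.

End TensorLemmas.

Section Correspondence.

Set Implicit Arguments.
Unset Strict Implicit.

Variables (E : category) (P : finite_products E).
Variables (C : monoidal_category) (L : functor E C).

Local Notation "A × B" := (prodo P A B) (at level 40, left associativity).
Local Notation p1 := (proj1 P _ _).
Local Notation p2 := (proj2 P _ _).
Local Notation "⟨ f , g ⟩" := (pairing P f g).

Lemma pairing_proj (A B : E) : ⟨p1, p2⟩ = idm (A × B).
Proof. by rewrite [RHS]pairing_uniq !comp_idr. Qed.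

(** * From oplax structures to natural comonoids *)

Section OfOplax.

Variable s : @oplax_monoidal (cartesian_monoidal P) C L.

(** The constraint of [s] with its source written as [L (A × B)] rather than
    through the tensor of the cartesian monoidal structure, so that the
    equations below can be rewritten syntactically. *)
Definition oplax_prod (A B : E) : L (A × B) ~> L A ⊗ L B := oplax_tensor s A B.

Definition oplax_comult (T : E) : L T ~> L T ⊗ L T :=
  oplax_prod T T ∘ fmap L (diag P T).

Definition oplax_counit (T : E) : L T ~> munit C :=
  oplax_unit s ∘ fmap L (bang P T).

Lemma oplax_prod_assoc (A B X : E) :
  assoc (L A) (L B) (L X) ∘ (oplax_prod A B ⊗m idm (L X))
    ∘ oplax_prod (A × B) X =
  (idm (L A) ⊗m oplax_prod B X) ∘ oplax_prod A (B × X)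
    ∘ fmap L (prod_assoc P A B X).
Proof. exact: (oplax_assoc s). Qed.

Lemma oplax_prod_lunit (A : E) :
  lunit (L A) ∘ (oplax_unit s ⊗m idm (L A)) ∘ oplax_prod (term P) A = fmap L p2.
Proof. exact: (oplax_lunit s). Qed.

Lemma oplax_prod_runit (A : E) :
  runit (L A) ∘ (idm (L A) ⊗m oplax_unit s) ∘ oplax_prod A (term P) = fmap L p1.
Proof. exact: (oplax_runit s). Qed.

(** Every pairing is [(f × g) ∘ diag], and [f × g] can be moved across the
    constraint by naturality. *)
Lemma oplax_tensor_pairing (X A B : E) (f : X ~> A) (g : X ~> B) :
  oplax_prod A B ∘ fmap L ⟨f, g⟩ = (fmap L f ⊗m fmap L g) ∘ oplax_comult X.
Proof.
have -> : ⟨f, g⟩ = prodm P f g ∘ diag P X.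
  by rewrite /prodm /diag pairing_comp proj1_pairing_comp proj2_pairing_comp
    !comp_idr.
rewrite fmap_comp comp_assoc /oplax_comult [RHS]comp_assoc.
by congr (_ ∘ _); exact: (oplax_tensor_nat s).
Qed.

Lemma oplax_counit_nat (T T' : E) (f : T ~> T') :
  oplax_counit T' ∘ fmap L f = oplax_counit T.
Proof.
by rewrite /oplax_counit -comp_assoc -fmap_comp (bang_uniq (bang P T' ∘ f)).
Qed.

Lemma oplax_comult_nat (T T' : E) (f : T ~> T') :
  oplax_comult T' ∘ fmap L f = (fmap L f ⊗m fmap L f) ∘ oplax_comult T.
Proof.
rewrite -oplax_tensor_pairing /oplax_comult -comp_assoc -fmap_comp.
by rewrite /diag pairing_comp comp_idl.
Qed.

(** [(idm ⊗ L bang) ∘ Phi T] factors through [L ⟨idm, bang⟩], a section of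
    [L proj1]; the right unit axiom of [s] then applies. *)
Lemma oplax_comult_counitr (T : E) :
  (idm (L T) ⊗m oplax_counit T) ∘ oplax_comult T = runit_inv (L T).
Proof.
rewrite -[RHS]comp_idr; apply: runit_inv_eq.
rewrite /oplax_counit -{1}(comp_idl (idm (L T))) -tensorm_comp_assoc.
rewrite -(fmap_id L) -oplax_tensor_pairing !comp_assoc fmap_id oplax_prod_runit.
by rewrite -fmap_comp proj1_pairing fmap_id.
Qed.

Lemma oplax_comult_counitl (T : E) :
  (oplax_counit T ⊗m idm (L T)) ∘ oplax_comult T = lunit_inv (L T).
Proof.
rewrite -[RHS]comp_idr; apply: lunit_inv_eq.
rewrite /oplax_counit -{1}(comp_idl (idm (L T))) -tensorm_comp_assoc.
rewrite -(fmap_id L) -oplax_tensor_pairing !comp_assoc fmap_id oplax_prod_lunit.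
by rewrite -fmap_comp proj2_pairing fmap_id.
Qed.

(** The diagonal is coassociative in [E]: reassociating [⟨diag, idm⟩] gives
    [⟨idm, diag⟩].  The associativity axiom of [s] transports this to [L T]. *)
Lemma oplax_comult_coassoc (T : E) :
  assoc_inv (L T) (L T) (L T) ∘ (idm (L T) ⊗m oplax_comult T) ∘ oplax_comult T =
  (oplax_comult T ⊗m idm (L T)) ∘ oplax_comult T.
Proof.
rewrite -comp_assoc; apply: assoc_inv_eq.
have diagA : prod_assoc P T T T ∘ ⟨diag P T, idm T⟩ = ⟨idm T, diag P T⟩.
  rewrite /prod_assoc !pairing_comp !proj1_pairing_comp proj2_pairing.
  by rewrite !proj1_pairing proj2_pairing.
have splitl : (oplax_comult T ⊗m idm (L T)) ∘ oplax_comult T =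
    (oplax_prod T T ⊗m idm (L T)) ∘
      (oplax_prod (T × T) T ∘ fmap L ⟨diag P T, idm T⟩).
  by rewrite oplax_tensor_pairing tensorm_comp_assoc fmap_id comp_idl.
have splitr : (idm (L T) ⊗m oplax_comult T) ∘ oplax_comult T =
    (idm (L T) ⊗m oplax_prod T T) ∘
      (oplax_prod T (T × T) ∘ fmap L ⟨idm T, diag P T⟩).
  by rewrite oplax_tensor_pairing tensorm_comp_assoc fmap_id comp_idl.
rewrite splitl splitr !comp_assoc oplax_prod_assoc -diagA fmap_comp.
by rewrite !comp_assoc.
Qed.

Definition comonoids_of_oplax : natural_comonoids L :=
  NaturalComonoids oplax_comult_counitr oplax_comult_counitl
    oplax_comult_coassoc oplax_counit_nat oplax_comult_nat.

End OfOplax.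

(** * From natural comonoids to oplax structures *)

Section OfComonoids.

Variable n : natural_comonoids L.

Definition comult_tensor (A B : E) : L (A × B) ~> L A ⊗ L B :=
  (fmap L p1 ⊗m fmap L p2) ∘ Phi n (A × B).

Lemma comult_tensor_pairing (X A B : E) (f : X ~> A) (g : X ~> B) :
  comult_tensor A B ∘ fmap L ⟨f, g⟩ = (fmap L f ⊗m fmap L g) ∘ Phi n X.
Proof.
rewrite /comult_tensor -comp_assoc Phi_nat tensorm_comp_assoc.
by rewrite -!fmap_comp proj1_pairing proj2_pairing.
Qed.

Lemma comult_tensor_nat (A A' B B' : E) (f : A ~> A') (g : B ~> B') :
  comult_tensor A' B' ∘ fmap L (prodm P f g) =
  (fmap L f ⊗m fmap L g) ∘ comult_tensor A B.
Proof.
by rewrite comult_tensor_pairing /comult_tensor tensorm_comp_assoc -!fmap_comp.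
Qed.

(** Either side is a twofold comultiplication of [L ((A × B) × X)] followed by
    the images of the three projections, so coassociativity applies. *)
Lemma comult_tensor_assoc (A B X : E) :
  assoc (L A) (L B) (L X) ∘ (comult_tensor A B ⊗m idm (L X))
    ∘ comult_tensor (A × B) X =
  (idm (L A) ⊗m comult_tensor B X) ∘ comult_tensor A (B × X)
    ∘ fmap L (prod_assoc P A B X).
Proof.
set Y := (A × B) × X.
set a := fmap L (p1 ∘ p1 : Y ~> A).
set b := fmap L (p2 ∘ p1 : Y ~> B).
set x := fmap L (p2 : Y ~> X).
have left3 : (comult_tensor A B ⊗m idm (L X)) ∘ comult_tensor (A × B) X =
    ((a ⊗m b) ⊗m x) ∘ ((Phi n Y ⊗m idm (L Y)) ∘ Phi n Y).
  rewrite {2}/comult_tensor !tensorm_comp_assoc comp_idl comp_idr.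
  rewrite /comult_tensor -comp_assoc Phi_nat [X in X ⊗m _]comp_assoc.
  by rewrite -tensorm_comp -!fmap_comp.
have right3 : (idm (L A) ⊗m comult_tensor B X) ∘
      (comult_tensor A (B × X) ∘ fmap L (prod_assoc P A B X)) =
    (a ⊗m (b ⊗m x)) ∘ ((idm (L Y) ⊗m Phi n Y) ∘ Phi n Y).
  by rewrite comult_tensor_pairing !tensorm_comp_assoc comult_tensor_pairing
    comp_idl comp_idr.
rewrite -[LHS]comp_assoc left3 -[RHS]comp_assoc right3 comp_assoc assoc_nat.
rewrite -comp_assoc -Phi_coassoc; congr (_ ∘ _).
by rewrite !comp_assoc assoc_invK comp_idl.
Qed.

(** Naturality of [Lambda] along [proj1] leaves the left counit law of
    [L (term × A)], and [L proj2] then crosses the unitor. *)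
Lemma comult_tensor_lunit (A : E) :
  lunit (L A) ∘ (Lambda n (term P) ⊗m idm (L A)) ∘ comult_tensor (term P) A =
  fmap L p2.
Proof.
rewrite -comp_assoc tensorm_comp_assoc Lambda_nat comp_idl.
rewrite -[Lambda n _]comp_idl -[fmap L p2 in LHS]comp_idr.
rewrite -tensorm_comp_assoc Phi_counitl comp_assoc lunit_nat.
by rewrite -comp_assoc lunit_invK comp_idr.
Qed.

Lemma comult_tensor_runit (A : E) :
  runit (L A) ∘ (idm (L A) ⊗m Lambda n (term P)) ∘ comult_tensor A (term P) =
  fmap L p1.
Proof.
rewrite -comp_assoc tensorm_comp_assoc Lambda_nat comp_idl.
rewrite -[Lambda n _]comp_idl -[fmap L p1 in LHS]comp_idr.
rewrite -tensorm_comp_assoc Phi_counitr comp_assoc runit_nat.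
by rewrite -comp_assoc runit_invK comp_idr.
Qed.

Definition oplax_of_comonoids : @oplax_monoidal (cartesian_monoidal P) C L :=
  @OplaxMonoidal (cartesian_monoidal P) C L comult_tensor (Lambda n (term P))
    comult_tensor_nat comult_tensor_assoc comult_tensor_lunit
    comult_tensor_runit.

End OfComonoids.

(** * The two constructions are mutually inverse *)

Lemma oplax_monoidal_ext (s t : @oplax_monoidal (cartesian_monoidal P) C L) :
  (forall A B : E, oplax_prod s A B = oplax_prod t A B) ->
  oplax_unit s = oplax_unit t -> s = t.
Proof.
rewrite /oplax_prod.
case: s t => [m e N1 A1 l1 r1] [m' e' N2 A2 l2 r2] /= eqm eqe.
have em : m = m'.
  by apply: functional_extensionality_dep => A;
     apply: functional_extensionality_dep => B; exact: eqm.
by subst m' e'; f_equal; exact: proof_irrelevance.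
Qed.

Lemma natural_comonoids_ext (n m : natural_comonoids L) :
  (forall T : E, Phi n T = Phi m T) ->
  (forall T : E, Lambda n T = Lambda m T) -> n = m.
Proof.
case: n m => [f l r1 l1 a1 nl1 nf1] [f' l' r2 l2 a2 nl2 nf2] /= eqf eql.
have ef : f = f' by exact: functional_extensionality_dep.
have el : l = l' by exact: functional_extensionality_dep.
by subst f' l'; f_equal; exact: proof_irrelevance.
Qed.

Lemma comonoids_of_oplaxK : cancel comonoids_of_oplax oplax_of_comonoids.
Proof.
move=> s; apply: oplax_monoidal_ext => [A B|].
  rewrite /oplax_prod /= /comult_tensor /= -oplax_tensor_pairing.
  by rewrite pairing_proj fmap_id comp_idr.
(* [term] has only one endomorphism, hence [bang term = idm]. *)
rewrite /= /oplax_counit -(bang_uniq (idm (term P))) fmap_id.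
exact: comp_idr.
Qed.

Lemma oplax_of_comonoidsK : cancel oplax_of_comonoids comonoids_of_oplax.
Proof.
move=> n; apply: natural_comonoids_ext => T /=.
  rewrite /oplax_comult /oplax_prod /= comult_tensor_pairing.
  by rewrite !fmap_id tensorm_id comp_idl.
exact: Lambda_nat.
Qed.

End Correspondence.

Theorem corollary22 (E : category) (P : finite_products E)
    (C : monoidal_category) (L : functor E C) :
  exists F : @oplax_monoidal (cartesian_monoidal P) C L -> natural_comonoids L,
    bijective F /\
    (forall (s : @oplax_monoidal (cartesian_monoidal P) C L) (T : E),
      Phi (F s) T = oplax_tensor s T T ∘ fmap L (diag P T) /\
      Lambda (F s) T = oplax_unit s ∘ fmap L (bang P T)).
Proof.
exists (@comonoids_of_oplax E P C L); split=> //.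
exact: (Bijective (@comonoids_of_oplaxK E P C L) (@oplax_of_comonoidsK E P C L)).
Qed.
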